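(* Let $n,m\in\mathbb{N}$ be positive, let $g_1,\dots,g_m:\mathbb{R}^n\to\mathbb{R}$ be convex functions, and let $\mathcal{S}=\bigcap_{k=1}^m\{x\in\mathbb{R}^n : g_k(x)\le 0\}$. Define $\widetilde{G}(x)=\sum_{k=1}^m g_k^+(x)$ for $x\in\mathbb{R}^n$, and let $x^\star\in\mathbb{R}^n$ be a global minimizer of $\widetilde{G}$ over $\mathbb{R}^n$, i.e. $x^\star=\mathrm{argmin}_{x\in\mathbb{R}^n}\widetilde{G}(x)$. Then the following are equivalent: (1) The set $\mathcal{S}$ is not empty, i.e. there exists $x^0\in\mathbb{R}^n$ such that $g_k(x^0)\le 0$ for all $k\in\{1,\dots,m\}$. (2) The point $x^\star$ satisfies $g_k(x^\star)\le 0$ for all $k\in\{1,\dots,m\}$.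
   Context: For a function $g_k:\mathbb{R}^n\to\mathbb{R}$, $g_k^+$ denotes its positive part: $g_k^+(x)=g_k(x)$ if $g_k(x)\ge 0$, and $g_k^+(x)=0$ if $g_k(x)\le 0$. *)

(* Defs.v *)
From mathcomp Require Import all_boot all_order all_algebra.
From mathcomp Require Import all_classical all_reals all_analysis.

Set Implicit Arguments.
Unset Strict Implicit.
Unset Printing Implicit Defensive.

Import Order.TTheory GRing.Theory Num.Theory.
Local Open Scope classical_set_scope.
Local Open Scope ring_scope.

Definition feasible_set (R : realType) (n m : nat)
    (g : 'I_m -> 'rV[R]_n -> R) : set 'rV[R]_n :=
  \bigcap_(k in [set: 'I_m]) [set x | g k x <= 0].

Definition sum_pos_part (R : realType) (n m : nat)
    (g : 'I_m -> 'rV[R]_n -> R) (x : 'rV[R]_n) : R :=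
  \sum_(k < m) (g k)^\+ x.

Definition global_minimizer (T : Type) (R : realType) (f : T -> R) (x : T) : Prop :=
  forall y : T, f x <= f y.

(* Main.v *)
Require Import Defs.
From mathcomp Require Import all_boot all_order all_algebra.
From mathcomp Require Import all_classical all_reals all_analysis.

(** The function [sum_pos_part g] is an exact penalty for the system
    [g k x <= 0]: as a sum of nonnegative terms it is nonpositive exactly where
    every term vanishes, that is, exactly on [feasible_set g]
    ([sum_pos_part_le0P]). The feasible set is thus a sublevel set, and a
    sublevel set that is nonempty contains every global minimizer. *)

Import Order.TTheory GRing.Theory Num.Theory.
Local Open Scope classical_set_scope.
Local Open Scope ring_scope.

(** The terms are nonnegative and so cannot compensate each other: a
    nonpositive sum forces each positive part to be zero. *)
Lemma sum_pos_part_le0P (R : realType) (n m : nat)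
    (g : 'I_m -> 'rV[R]_n -> R) (x : 'rV[R]_n) :
  sum_pos_part g x <= 0 <-> feasible_set g x.
Proof.
have pos_ge0 k : true -> 0 <= (g k)^\+ x by move=> _; exact: funrpos_ge0.
split=> [sum_le0 k _ /=|feas_x].
  have sum_eq0 : sum_pos_part g x == 0.
    by rewrite eq_le sum_le0 sumr_ge0.
  move: sum_eq0; rewrite psumr_eq0// => /allP/(_ k).
  rewrite mem_index_enum => /(_ isT) /eqP pos_eq0.
  by rewrite -pos_eq0 /funrpos le_max lexx.
rewrite /sum_pos_part big1// => k _.
by apply/max_idPr; exact: feas_x.
Qed.

Theorem lemma2p1 (R : realType) (n m : nat) (n_gt0 : (0 < n)%N) (m_gt0 : (0 < m)%N)
    (g : 'I_m -> 'rV[R]_n -> R)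
    (g_convex : forall k : 'I_m, @convex_function R 'rV[R]_n [set: 'rV[R]_n] (g k))
    (xstar : 'rV[R]_n) (xstar_min : global_minimizer (sum_pos_part g) xstar) :
  feasible_set g !=set0 <-> (forall k : 'I_m, g k xstar <= 0).
Proof.
split=> [[x0 /sum_pos_part_le0P x0_le0] k|xstar_feas].
  have /sum_pos_part_le0P xstar_feas : sum_pos_part g xstar <= 0.
    exact: le_trans (xstar_min x0) x0_le0.
  exact: xstar_feas.
by exists xstar => k _; exact: xstar_feas.
Qed.
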